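(* Let $D$ be a set with $|D|\geq 3$, let $a,b,0_{\dashv}\in D$ be pairwise distinct, and let $c,0_{\vdash}\in D$ be such that $a,c,0_{\vdash}$ are pairwise distinct. Define two binary operations $\dashv$ and $\vdash$ on $D$ by $$ x\dashv y= \begin{cases} b,&\text{if }x=y=a\\ 0_{\dashv},&\text{otherwise} \end{cases} \quad\text{and}\quad x\vdash y= \begin{cases} c,&\text{if }x=y=a\\ 0_{\vdash},&\text{otherwise}. \end{cases} $$ Then $(D,\dashv,\vdash)$ is a $2$-dinilpotent commutative $g$-dimonoid. Moreover, it is a dimonoid if and only if $0_{\dashv}=0_{\vdash}$.
   Context: A $g$-dimonoid is a set $D$ with two associative binary operations $\dashv,\vdash$ satisfying, for all $x,y,z\in D$, $(D_1)$ $(x\dashv y)\dashv z=x\dashv(y\vdash z)$ and $(D_3)$ $(x\dashv y)\vdash z=x\vdash(y\vdash z)$. A dimonoid is a $g$-dimonoid which also satisfies $(D_2)$ $(x\vdash y)\dashv z=x\vdash(y\dashv z)$ for all $x,y,z\in D$. A $g$-dimonoid is commutative if both semigroups $(D,\dashv)$ and $(D,\vdash)$ are commutative. A semigroup $S$ with zero $0$ is nilpotent if $S^{n+1}=\{0\}$ for some $n\in\mathbb N$; the least such $n$ is its nilpotency index; $S$ is $n$-nilpotent if it is nilpotent of nilpotency index $\le n$ (so $2$-nilpotent means that all products of three elements equal the zero). A $g$-dimonoid $(D,\dashv,\vdash)$ is $n$-dinilpotent if both semigroups $(D,\dashv)$ and $(D,\vdash)$ are $n$-nilpotent; each of the two semigroups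 has its own zero, and these two zeros are allowed to be distinct. *)

(* Defs.v *)
From mathcomp Require Import all_boot.
From mathcomp Require Import boolp classical_sets functions cardinality.

Set Implicit Arguments.
Unset Strict Implicit.
Unset Printing Implicit Defensive.

Local Open Scope classical_set_scope.

Section Dimonoids.
Variable D : Type.
Implicit Types (op dl dr : D -> D -> D) (z : D).

Definition is_zero op z : Prop := left_zero z op /\ right_zero z op.

(* [powS op n] is S^(n+1), the set of all products of n+1 elements;
   products are bracketed to the left. *)
Fixpoint powS op (n : nat) : set D :=
  if n is m.+1 then [set op x y | x in powS op m & y in [set: D]] else [set: D].

(* [n] is the least positive integer such that S^(n+1) = {z}. *)
Definition nilpotency_index op z (n : nat) : Prop :=
  [/\ 0 < n, powS op n = [set z] &
      forall k, 0 < k -> powS op k = [set z] -> n <= k].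

Definition n_nilpotent op (n : nat) : Prop :=
  associative op /\
  exists z, is_zero op z /\ exists m, nilpotency_index op z m /\ m <= n.

(* [dl] is the operation written with a left tack, [dr] the one written with
   a right tack. *)
Record g_dimonoid dl dr : Prop := GDimonoid {
  dl_assoc : associative dl;
  dr_assoc : associative dr;
  dimonoidD1 : forall x y t, dl (dl x y) t = dl x (dr y t);
  dimonoidD3 : forall x y t, dr (dl x y) t = dr x (dr y t)
}.

Record dimonoid dl dr : Prop := Dimonoid {
  dimonoid_g : g_dimonoid dl dr;
  dimonoidD2 : forall x y t, dl (dr x y) t = dr x (dl y t)
}.

Definition commutative_g_dimonoid dl dr : Prop :=
  [/\ g_dimonoid dl dr, commutative dl & commutative dr].

Definition dinilpotent_g_dimonoid dl dr (n : nat) : Prop :=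
  [/\ g_dimonoid dl dr, n_nilpotent dl n & n_nilpotent dr n].

(* [D] carries no decidable equality, so the case distinction is classical. *)
Definition square_op (a b z : D) : D -> D -> D :=
  fun x y => if `[< x = a /\ y = a >] then b else z.

End Dimonoids.

(* Main.v *)
Require Import Defs.
From mathcomp Require Import all_boot.
From mathcomp Require Import boolp classical_sets functions cardinality.

Local Open Scope classical_set_scope.
Local Open Scope card_scope.

(** The element [a] is the only one with a nontrivial product, and it is never
    itself a product, since [b], [c] and both zeros differ from it. So a product
    with a product as a factor is the zero of the outer operation, whatever the
    inner operation ([square_op_prodl], [square_op_prodr]). The two sides of
    associativity, of D1 and of D3 have the same outer operation, hence agree.
    The two sides of D2 have different outer operations: they are constantly
    [zl] and [zr], and agree exactly when the two zeros do. Finally the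
    nilpotency index is exactly 2, because the square of [a] is a nonzero
    product of two elements. *)

Section SquareOp.
Variables (D : Type) (a : D).

Lemma square_op_diag (b z : D) : square_op a b z a a = b.
Proof. by rewrite /square_op; case: asboolP => // -[]. Qed.

Lemma square_op_neql (b z x y : D) : x <> a -> square_op a b z x y = z.
Proof. by move=> xa; rewrite /square_op; case: asboolP => // -[]. Qed.

Lemma square_op_neqr (b z x y : D) : y <> a -> square_op a b z x y = z.
Proof. by move=> ya; rewrite /square_op; case: asboolP => // -[]. Qed.

Lemma square_op_neq (b z x y : D) :
  a <> b -> a <> z -> square_op a b z x y <> a.
Proof. by move=> ab az; rewrite /square_op; case: ifP => _ /esym. Qed.

Lemma square_opC (b z : D) : commutative (square_op a b z).
Proof.
move=> x y; rewrite /square_op; congr (if _ then _ else _).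
by apply: asbool_equiv_eq; split=> -[].
Qed.

(** The outer and inner operations are independent, so that this lemma and its
    mirror image evaluate both sides of associativity, D1, D2 and D3. *)
Lemma square_op_prodl (b z c w x y t : D) : a <> c -> a <> w ->
  square_op a b z (square_op a c w x y) t = z.
Proof. by move=> ac aw; apply/square_op_neql/square_op_neq. Qed.

Lemma square_op_prodr (b z c w x y t : D) : a <> c -> a <> w ->
  square_op a b z x (square_op a c w y t) = z.
Proof. by move=> ac aw; apply/square_op_neqr/square_op_neq. Qed.

Lemma square_opA (b z : D) : a <> b -> a <> z -> associative (square_op a b z).
Proof. by move=> ab az x y t; rewrite square_op_prodl// square_op_prodr. Qed.

Lemma square_op_zero (b z : D) : a <> z -> is_zero (square_op a b z) z.
Proof.
by move=> /nesym za; split=> x; [apply: square_op_neql|apply: square_op_neqr].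
Qed.

Lemma square_op_nilpotency_index (b z : D) : a <> b -> a <> z -> b <> z ->
  nilpotency_index (square_op a b z) z 2.
Proof.
move=> ab az bz; split=> //.
  apply/seteqP; split=> [_ [_ [x _ [y _ <-]] [t _ <-]]|_ ->].
    exact: square_op_prodl.
  exists (square_op a b z a a); first by exists a => //; exists a.
  by exists a => //; exact: square_op_prodl.
(* Index 1 would put the square [b] of [a] in the singleton of [z]. *)
case=> [|[|k]] // _ pow1; exfalso; apply: bz.
suff: powS (square_op a b z) 1 b by rewrite pow1.
by exists a => //; exists a => //; exact: square_op_diag.
Qed.

Lemma square_op_n_nilpotent (b z : D) : a <> b -> a <> z -> b <> z ->
  n_nilpotent (square_op a b z) 2.
Proof.
move=> ab az bz; split; first exact: square_opA.
exists z; split; first exact: square_op_zero.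
by exists 2; split=> //; exact: square_op_nilpotency_index.
Qed.

Lemma square_op_g_dimonoid (b zl c zr : D) :
  a <> b -> a <> zl -> a <> c -> a <> zr ->
  g_dimonoid (square_op a b zl) (square_op a c zr).
Proof.
move=> ab azl ac azr.
split; [exact: square_opA|exact: square_opA| |] => x y t;
  by rewrite square_op_prodl// square_op_prodr.
Qed.

Lemma square_op_dimonoid (b zl c zr : D) :
  a <> b -> a <> zl -> a <> c -> a <> zr ->
  dimonoid (square_op a b zl) (square_op a c zr) <-> zl = zr.
Proof.
move=> ab azl ac azr; split=> [[_ /(_ a a a)]|zlr].
  by rewrite square_op_prodl// square_op_prodr.
split; first exact: square_op_g_dimonoid.
by move=> x y t; rewrite square_op_prodl// square_op_prodr.
Qed.

End SquareOp.

Theorem proposition3p1 (D : Type) (hD : `I_3 #<= [set: D])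
    (a b zl c zr : D)
    (hab : a <> b) (hazl : a <> zl) (hbzl : b <> zl)
    (hac : a <> c) (hazr : a <> zr) (hczr : c <> zr) :
  let dl := square_op a b zl in
  let dr := square_op a c zr in
  dinilpotent_g_dimonoid dl dr 2 /\
  commutative_g_dimonoid dl dr /\
  (dimonoid dl dr <-> zl = zr).
Proof.
move=> dl dr.
have gD : g_dimonoid dl dr by exact: square_op_g_dimonoid.
split; first by split=> //; exact: square_op_n_nilpotent.
split; first by split=> //; exact: square_opC.
exact: square_op_dimonoid.
Qed.
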